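(* Let $R$ be a ring and let $\Delta$ be a multiplicatively closed subset of $R$ consisting of central non-zero divisors. Then $R$ is nil-reversible if and only if the localization $\Delta^{-1}R$ is nil-reversible.
   Context: All rings are associative with identity. For a ring $R$, $N(R)$ denotes the set of all nilpotent elements of $R$. For $a\in R$, $l(a)=\{x\in R: xa=0\}$ and $r(a)=\{x\in R: ax=0\}$. A ring $R$ is nil-reversible if $l(a)=r(a)$ for every $a\in N(R)$. *)

(* Defs.v *)
From HB Require Import structures.
From mathcomp Require Import all_boot all_algebra.
From mathcomp Require Import boolp classical_sets.

Set Implicit Arguments.
Unset Strict Implicit.
Unset Printing Implicit Defensive.

Import GRing.Theory.

Local Open Scope quotient_scope.
Local Open Scope classical_set_scope.
Local Open Scope ring_scope.

Section NilReversible.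
Variable R : pzRingType.

Definition nilpotents : set R := [set a | exists n : nat, a ^+ n = 0].

Definition lann (a : R) : set R := [set x | x * a = 0].

Definition rann (a : R) : set R := [set x | a * x = 0].

Definition nil_reversible : Prop :=
  forall a : R, nilpotents a -> lann a = rann a.

(* 1 is not required to belong to D, but D must be nonempty for the fractions
   u^-1 a (a in R, u in D) to form a ring. *)
Definition mul_closed (D : set R) : Prop :=
  D !=set0 /\ (forall u v, D u -> D v -> D (u * v)).

Definition central (u : R) : Prop := forall x : R, u * x = x * u.

Definition non_zero_divisor (u : R) : Prop :=
  forall x : R, (u * x = 0 -> x = 0) /\ (x * u = 0 -> x = 0).

Definition localizable (D : set R) : Prop :=
  mul_closed D /\ (forall u, D u -> central u /\ non_zero_divisor u).

End NilReversible.

Module Loc.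
Section Loc.
Variables (R : pzRingType) (D : set R) (DP : localizable D).

Local Notation den := {u : R | u \in D}.

(* The pair (a, u) stands for the fraction u^-1 a. *)
Definition prefrac := (R * den)%type.

Implicit Types (x y z : prefrac) (u v w : den).

Lemma denC u (a : R) : val u * a = a * val u.
Proof. by have /set_mem/DP.2[] := valP u. Qed.

Lemma denI u (a b : R) : val u * a = val u * b -> a = b.
Proof.
have /set_mem/DP.2[_ reg] := valP u.
move=> e; apply/eqP; rewrite -subr_eq0; apply/eqP.
by apply: (reg _).1; rewrite mulrBr e subrr.
Qed.

Lemma den_inhabited : {u : R | u \in D}.
Proof.
have ex : exists x : R, x \in D by case: DP.1.1 => u Du; exists u; apply/mem_set.
by exists (xchoose ex); apply: xchooseP.
Qed.

Fact denM_subproof u v : val u * val v \in D.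
Proof. by apply/mem_set/DP.1.2; apply/set_mem/valP. Qed.

Definition denM u v : den := Sub (val u * val v) (denM_subproof u v).

(* As denominators are regular, u^-1 a = v^-1 b amounts to v a = u b, without
   the usual extra factor from D. *)
Definition eqfrac x y : bool := val y.2 * x.1 == val x.2 * y.1.

Lemma eqfrac_refl : reflexive eqfrac.
Proof. by move=> x; rewrite /eqfrac. Qed.

Lemma eqfrac_sym : symmetric eqfrac.
Proof. by move=> x y; rewrite /eqfrac eq_sym. Qed.

Lemma eqfrac_trans : transitive eqfrac.
Proof.
move=> [b v] [a u] [c w]; rewrite /eqfrac /= => /eqP ab /eqP bc.
apply/eqP; apply: (@denI v).
by rewrite mulrA (denC v (val w)) -mulrA ab !mulrA -(denC u) -!mulrA bc mulrA
           (denC u) -mulrA.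
Qed.

Canonical eqfrac_equiv := EquivRel eqfrac eqfrac_refl eqfrac_sym eqfrac_trans.

Definition type := {eq_quot eqfrac}.

HB.instance Definition _ : EqQuotient _ eqfrac type := EqQuotient.on type.
HB.instance Definition _ := Choice.on type.

Definition frac (a : R) (u : den) : type := \pi_type (a, u).

Lemma fracP a b u v : frac a u = frac b v <-> val v * a = val u * b.
Proof. by split=> [/eqmodP/eqP|e]; last by apply/eqmodP/eqP. Qed.

Lemma fracW (P : type -> Prop) : (forall a u, P (frac a u)) -> forall s, P s.
Proof. by move=> Pf; elim/quotW=> -[a u]; apply: Pf. Qed.

Definition zero : type := frac 0 den_inhabited.
Definition one : type := frac (val den_inhabited) den_inhabited.
Definition opp (s : type) : type := frac (- (repr s).1) (repr s).2.
Definition add (s t : type) : type :=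
  frac (val (repr t).2 * (repr s).1 + val (repr s).2 * (repr t).1)
       (denM (repr s).2 (repr t).2).
Definition mul (s t : type) : type :=
  frac ((repr s).1 * (repr t).1) (denM (repr s).2 (repr t).2).

Lemma repr_frac a u : val u * (repr (frac a u)).1 = val (repr (frac a u)).2 * a.
Proof.
by apply/fracP; rewrite /frac -surjective_pairing reprK.
Qed.

Lemma mulCA u (a b : R) : a * (val u * b) = val u * (a * b).
Proof. by rewrite mulrA -denC mulrA. Qed.

Lemma fracN a u : opp (frac a u) = frac (- a) u.
Proof. by apply/fracP; rewrite !mulrN repr_frac. Qed.

Lemma fracD a b u v :
  add (frac a u) (frac b v) = frac (val v * a + val u * b) (denM u v).
Proof.
apply/fracP => /=.
have := repr_frac a u; have := repr_frac b v.
case: (repr (frac a u)) => a' u'; case: (repr (frac b v)) => b' v' /= eb ea.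
rewrite !mulrDr; congr (_ + _).
  by rewrite -!mulrA -!(mulCA u) ea !(mulCA u') (mulCA v').
by rewrite -!mulrA -(mulCA v) eb !(mulCA v') !(mulCA u').
Qed.

Lemma fracM a b u v : mul (frac a u) (frac b v) = frac (a * b) (denM u v).
Proof.
apply/fracP => /=.
have := repr_frac a u; have := repr_frac b v.
case: (repr (frac a u)) => a' u'; case: (repr (frac b v)) => b' v' /= eb ea.
by rewrite -!mulrA -(mulCA v) eb mulrA ea -mulrA (mulCA v').
Qed.

Lemma frac_scale a u v : frac (val v * a) (denM v u) = frac a u.
Proof. by apply/fracP; rewrite /= -mulrA mulCA. Qed.

Lemma frac_scaler a u v : frac (val v * a) (denM u v) = frac a u.
Proof. by apply/fracP; rewrite /= -mulrA. Qed.

Lemma fracDs a b u : add (frac a u) (frac b u) = frac (a + b) u.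
Proof. by rewrite fracD -mulrDr frac_scale. Qed.

(* Reduction to a common denominator. *)
Lemma fracW3 (P : type -> type -> type -> Prop) :
  (forall a b c u, P (frac a u) (frac b u) (frac c u)) ->
  forall s t r, P s t r.
Proof.
move=> Pf; elim/fracW=> a u; elim/fracW=> b v; elim/fracW=> c w.
rewrite -(frac_scaler a u v) -(frac_scale b v u) -(frac_scale c w (denM u v)).
rewrite -(frac_scaler (val v * a) (denM u v) w).
rewrite -(frac_scaler (val u * b) (denM u v) w).
exact: Pf.
Qed.

Lemma addA : associative add.
Proof.
apply: (@fracW3 (fun s t r => add s (add t r) = add (add s t) r)).
by move=> a b c u; rewrite !fracDs addrA.
Qed.

Lemma addC : commutative add.
Proof.
move=> s t; apply: (@fracW3 (fun s t _ => add s t = add t s) _ s t s).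
by move=> a b _ u; rewrite !fracDs addrC.
Qed.

Lemma frac0 u : frac 0 u = zero.
Proof. by apply/fracP; rewrite !mulr0. Qed.

Lemma fracuu u : frac (val u) u = one.
Proof. by apply/fracP; rewrite denC. Qed.

Lemma add0s : left_id zero add.
Proof. by elim/fracW=> a u; rewrite -(frac0 u) fracDs add0r. Qed.

Lemma addNs : left_inverse zero opp add.
Proof. by elim/fracW=> a u; rewrite fracN fracDs addNr frac0. Qed.

HB.instance Definition _ := GRing.isZmodule.Build type addA addC add0s addNs.

Lemma mulA : associative mul.
Proof.
apply: (@fracW3 (fun s t r => mul s (mul t r) = mul (mul s t) r)).
by move=> a b c u; rewrite !fracM mulrA; apply/fracP; rewrite /= !mulrA.
Qed.

Lemma mul1s : left_id one mul.
Proof. by elim/fracW=> a u; rewrite -(fracuu u) fracM frac_scale. Qed.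

Lemma muls1 : right_id one mul.
Proof. by elim/fracW=> a u; rewrite -(fracuu u) fracM -denC frac_scaler. Qed.

Lemma mulDl : left_distributive mul add.
Proof.
apply: (@fracW3 (fun s t r => mul (add s t) r = add (mul s r) (mul t r))).
by move=> a b c u; rewrite fracDs !fracM fracDs mulrDl.
Qed.

Lemma mulDr : right_distributive mul add.
Proof.
apply: (@fracW3 (fun s t r => mul s (add t r) = add (mul s t) (mul s r))).
by move=> a b c u; rewrite fracDs !fracM fracDs mulrDr.
Qed.

HB.instance Definition _ :=
  GRing.Zmodule_isPzRing.Build type mulA mul1s muls1 mulDl mulDr.

(* The canonical map a |-> a / 1, written so as not to need 1 in D. *)
Definition tofrac (a : R) : type := frac (val den_inhabited * a) den_inhabited.

Lemma tofracE a u : tofrac a = frac (val u * a) u.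
Proof. by apply/fracP; rewrite mulCA. Qed.

Lemma tofrac_is_zmod_morphism : zmod_morphism tofrac.
Proof.
move=> a b; rewrite /tofrac; set d := den_inhabited.
by rewrite -[- frac _ d]/(opp _) fracN -[RHS]/(add _ _) fracDs mulrBr.
Qed.

Lemma tofrac_is_monoid_morphism : monoid_morphism tofrac.
Proof.
split=> [|a b]; rewrite /tofrac; set d := den_inhabited; first by rewrite mulr1.
rewrite -[RHS]/(mul _ _) fracM; apply/fracP => /=.
by rewrite -!mulrA (mulCA d a b).
Qed.

HB.instance Definition _ :=
  GRing.isZmodMorphism.Build R type tofrac tofrac_is_zmod_morphism.
HB.instance Definition _ :=
  GRing.isMonoidMorphism.Build R type tofrac tofrac_is_monoid_morphism.

Lemma tofrac_inj : injective tofrac.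
Proof. by move=> a b /fracP /denI /denI. Qed.

Lemma tofrac_den_inv u :
  {s : type | s * tofrac (val u) = 1 & tofrac (val u) * s = 1}.
Proof.
exists (frac (val u) (denM u u)); rewrite (tofracE _ u) -[LHS]/(mul _ _) fracM;
  rewrite -[RHS](fracuu u); by apply/fracP; rewrite /= !mulrA.
Qed.

Lemma frac_div a u : tofrac (val u) * frac a u = tofrac a.
Proof.
rewrite (tofracE _ u) (tofracE _ u) -[LHS]/(mul _ _) fracM.
by apply/fracP; rewrite /= !mulrA.
Qed.

End Loc.
End Loc.
HB.export Loc.

Notation localization := Loc.type.
Arguments Loc.type [R D] DP.

(* Main.v *)
Require Import Defs.
From mathcomp Require Import all_boot all_algebra.
From mathcomp Require Import boolp classical_sets.

(** Nil-reversibility says that x a = 0 and a x = 0 are equivalent whenever a is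
    nilpotent, so it only involves the vanishing of products and of powers.

    An injective ring morphism preserves and reflects both kinds of vanishing,
    so nil-reversibility descends to subrings ([nil_reversible_inj]); as the
    denominators are regular, R embeds in its localization, which gives one
    implication.

    For the other one, denominators are central and regular: products of
    fractions are computed on numerators, and a fraction vanishes exactly when
    its numerator does.  Hence u^-1 a is nilpotent if and only if a is
    ([nilpotents_frac]), a product of two fractions is zero if and only if the
    product of their numerators is ([frac_mul_eq0]), and the condition on R
    applies to the numerators. *)

Set Implicit Arguments.
Unset Strict Implicit.
Unset Printing Implicit Defensive.

Import GRing.Theory.

Local Open Scope classical_set_scope.
Local Open Scope ring_scope.

Lemma nil_reversibleP (R : pzRingType) :
  nil_reversible R <->
  (forall a x : R, nilpotents a -> (x * a = 0 <-> a * x = 0)).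
Proof.
split=> [nrR a x /nrR/seteqP[lr rl]|nrR a nil_a].
  by split; [apply: lr | apply: rl].
by apply/seteqP; split=> x; apply (nrR a x nil_a).
Qed.

Lemma nil_reversible_inj (R S : pzRingType) (f : {rmorphism R -> S}) :
  injective f -> nil_reversible S -> nil_reversible R.
Proof.
move=> f_inj /nil_reversibleP nrS; apply/nil_reversibleP=> a x [n an0].
have f_eq0 y : f y = 0 <-> y = 0.
  by split=> [fy0|->]; [apply: f_inj; rewrite fy0|]; rewrite rmorph0.
have nil_fa : nilpotents (f a) by exists n; rewrite -rmorphXn an0 rmorph0.
by rewrite -!f_eq0 !rmorphM; apply: nrS.
Qed.

Section Fractions.
Variables (R : pzRingType) (D : set R) (DP : localizable D).

Local Notation den := {u : R | u \in D}.

Implicit Types (a b : R) (u v : den).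

Lemma frac_eq0 a u : Loc.frac DP a u = 0 <-> a = 0.
Proof.
split=> [|->]; last exact: Loc.frac0.
by rewrite -[0]/(Loc.zero DP) -(Loc.frac0 DP u) => /Loc.fracP; apply: Loc.denI.
Qed.

Lemma frac_mul_eq0 a b u v :
  Loc.frac DP a u * Loc.frac DP b v = 0 <-> a * b = 0.
Proof. by rewrite -[_ * _]/(Loc.mul _ _) Loc.fracM frac_eq0. Qed.

(** The exponent is positive because the power 0 of any fraction is 1, and
    w^-1 a ^+ 0 equals 1 only for w = 1, which may lie outside D. *)
Lemma frac_expS a u n :
  exists w, Loc.frac DP a u ^+ n.+1 = Loc.frac DP (a ^+ n.+1) w.
Proof.
elim: n => [|n [w IHn]]; first by exists u; rewrite !expr1.
exists (Loc.denM DP u w).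
by rewrite exprS IHn -[LHS]/(Loc.mul _ _) Loc.fracM -exprS.
Qed.

Lemma nilpotentsS (S : pzRingType) (a : S) :
  nilpotents a <-> exists n, a ^+ n.+1 = 0.
Proof.
by split=> -[n an0]; [exists n; rewrite exprS an0 mulr0 | exists n.+1].
Qed.

Lemma nilpotents_frac a u : nilpotents (Loc.frac DP a u) <-> nilpotents a.
Proof.
rewrite !nilpotentsS.
by split=> -[n an0]; exists n; have [w fw] := frac_expS a u n;
  move: an0; rewrite fw frac_eq0.
Qed.

End Fractions.

Theorem proposition3p3 (R : pzRingType) (D : set R) (DP : localizable D) :
  nil_reversible R <-> nil_reversible (localization DP).
Proof.
split=> [/nil_reversibleP nrR|]; last exact/nil_reversible_inj/Loc.tofrac_inj.
apply/nil_reversibleP; elim/Loc.fracW=> a u; elim/Loc.fracW=> b v.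
by rewrite nilpotents_frac !frac_mul_eq0; apply: nrR.
Qed.
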